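(* For $\ell\in\mathbb{N}$ the following $q$-recursion formulas hold. (i) For $\mathbf{\Phi}_1$ (with $q^\gamma\neq 1,q^{-1},q^{-2},\dots$): $$\mathbf{\Phi}_{1}(q^{\alpha+\ell},q^\beta;q^\gamma;q,x,y)=\mathbf{\Phi}_{1}(q^{\alpha},q^{\beta};q^{\gamma};q,x,y)+\frac{q^{\alpha}x(1-q^{\beta})}{1-q^{\gamma}}\sum_{r=1}^{\ell}q^{r-1}\mathbf{\Phi}_{1}(q^{\alpha+r},q^{\beta+1};q^{\gamma+1};q,x,y)+\frac{q^{\alpha}y}{1-q^{\gamma}}\sum_{r=1}^{\ell}q^{r-1}\mathbf{\Phi}_{1}(q^{\alpha+r},q^{\beta};q^{\gamma+1};q,qx,y),$$ $$\mathbf{\Phi}_{1}(q^{\alpha+\ell},q^\beta;q^\gamma;q,x,y)=\mathbf{\Phi}_{1}(q^{\alpha},q^{\beta};q^{\gamma};q,x,y)+\frac{q^{\alpha}y}{1-q^{\gamma}}\sum_{r=1}^{\ell}q^{r-1}\mathbf{\Phi}_{1}(q^{\alpha+r},q^{\beta+1};q^{\gamma+1};q,x,y)+\frac{q^{\alpha}x(1-q^{\beta})}{1-q^{\gamma}}\sum_{r=1}^{\ell}q^{r-1}\mathbf{\Phi}_{1}(q^{\alpha+r},q^{\beta};q^{\gamma+1};q,x,qy),$$ $$\mathbf{\Phi}_{1}(q^\alpha,q^{\beta+\ell};q^\gamma;q,x,y)=\mathbf{\Phi}_{1}(q^{\alpha},q^{\beta};q^{\gamma};q,x,y)+\frac{q^{\beta}x(1-q^{\alpha})}{1-q^{\gamma}}\sum_{r=1}^{\ell}q^{r-1}\mathbf{\Phi}_{1}(q^{\alpha},q^{\beta+\ell};q^{\gamma+1};q,x,y).$$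 (ii) For $\mathbf{\Phi}_2$ (with $q^\gamma\neq 1,q^{-1},q^{-2},\dots$): $$\mathbf{\Phi}_{2}(q^{\alpha+\ell},q^\beta;q^\gamma;q,x,y)=\mathbf{\Phi}_{2}(q^{\alpha},q^{\beta};q^{\gamma};q,x,y)+\frac{q^{\alpha}x}{1-q^{\gamma}}\sum_{r=1}^{\ell}q^{r-1}\mathbf{\Phi}_{2}(q^{\alpha+r},q^\beta;q^{\gamma+1};q,x,y),$$ $$\mathbf{\Phi}_{2}(q^\alpha,q^{\beta+\ell};q^\gamma;q,x,y)=\mathbf{\Phi}_{2}(q^{\alpha},q^{\beta};q^{\gamma};q,x,y)+\frac{q^{\alpha}y}{1-q^{\gamma}}\sum_{r=1}^{\ell}q^{r-1}\mathbf{\Phi}_{2}(q^\alpha,q^{\beta+r};q^{\gamma+1};q,qx,y).$$ (iii) For $\mathbf{\Phi}_3$ (with $q^\beta\neq 1,q^{-1},q^{-2},\dots$): $$\mathbf{\Phi}_{3}(q^{\alpha+\ell};q^\beta;q,x,y)=\mathbf{\Phi}_{3}(q^{\alpha};q^{\beta};q,x,y)+\frac{q^{\alpha}x}{1-q^{\beta}}\sum_{r=1}^{\ell}q^{r-1}\mathbf{\Phi}_{3}(q^{\alpha+r};q^{\beta+1};q,x,y).$$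
   Context: Let $q\in\mathbb{C}$ with $0<|q|<1$. The $q$-shifted factorial is $(a;q)_0=1$, $(a;q)_\ell=\prod_{j=0}^{\ell-1}(1-aq^j)$ for $\ell\ge 1$. The basic Humbert hypergeometric functions are defined by the double series $$\mathbf{\Phi}_{1}(q^{\alpha},q^{\beta};q^{\gamma};q,x,y)=\sum_{n,k=0}^{\infty}\frac{(q^{\alpha};q)_{n+k}(q^{\beta};q)_{n}}{(q^{\gamma};q)_{n+k}(q;q)_{n}(q;q)_{k}}x^{n}y^{k},$$ $$\mathbf{\Phi}_{2}(q^{\alpha},q^{\beta};q^{\gamma};q,x,y)=\sum_{n,k=0}^{\infty}\frac{(q^{\alpha};q)_{n}(q^{\beta};q)_{k}}{(q^{\gamma};q)_{n+k}(q;q)_{n}(q;q)_{k}}x^{n}y^{k},$$ $$\mathbf{\Phi}_{3}(q^{\alpha};q^{\beta};q,x,y)=\sum_{n,k=0}^{\infty}\frac{(q^{\alpha};q)_{n}}{(q^{\beta};q)_{n+k}(q;q)_{n}(q;q)_{k}}x^{n}y^{k},$$ where the denominator parameter ($q^\gamma$ for $\mathbf\Phi_1,\mathbf\Phi_2$; $q^\beta$ for $\mathbf\Phi_3$) is different from $1,q^{-1},q^{-2},\dots$.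
   Formalization: Three false formulas are corrected: 2nd Φ1: q^β in the y-sum, q^{β+1} in the x-sum; 3rd Φ1: summand Φ1(q^{α+1},q^{β+r};q^{γ+1};q,x,y); 2nd Φ2: prefactor q^β y, argument x instead of qx. The implicit convergence domain |x|<1, |y|<1 is assumed. *)

(* Defs.v *)
From Stdlib Require Import Reals.
From Coquelicot Require Import Coquelicot.

Open Scope C_scope.

Definition Cexp (z : C) : C :=
  (exp (fst z) * cos (snd z), exp (fst z) * sin (snd z))%R.

(* The power [q^s] for complex [s], where [L] is a chosen logarithm of the base,
   i.e. [Cexp L = q].  Results quantify over all such [L], hence over every
   branch. *)
Definition qpow (L s : C) : C := Cexp (s * L).

Fixpoint qpoch (a q : C) (l : nat) : C :=
  match l with
  | O => 1
  | S j => qpoch a q j * (1 - a * q ^ j)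
  end.

(* Convergence of the rectangular partial sums when both sides of the rectangle
   tend independently to infinity. *)
Definition is_dseries (a : nat -> nat -> C) (s : C) : Prop :=
  filterlim
    (fun NK : nat * nat =>
       sum_n (fun n => sum_n (fun k => a n k) (snd NK)) (fst NK))
    (filter_prod eventually eventually) (locally s).

(* The sum of a convergent double series; unspecified if it diverges. *)
Definition DSeries (a : nat -> nat -> C) : C := iota (T := C_CompleteNormedModule) (is_dseries a).

(* The arguments [a], [b], [c] below are the powers q^alpha, q^beta, q^gamma
   themselves, not the exponents. *)
Definition Phi1 (a b c q x y : C) : C :=
  DSeries (fun n k =>
    (qpoch a q (n + k) * qpoch b q n)
      / (qpoch c q (n + k) * qpoch q q n * qpoch q q k) * x ^ n * y ^ k).

Definition Phi2 (a b c q x y : C) : C :=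
  DSeries (fun n k =>
    (qpoch a q n * qpoch b q k)
      / (qpoch c q (n + k) * qpoch q q n * qpoch q q k) * x ^ n * y ^ k).

Definition Phi3 (a b q x y : C) : C :=
  DSeries (fun n k =>
    qpoch a q n
      / (qpoch b q (n + k) * qpoch q q n * qpoch q q k) * x ^ n * y ^ k).

(* [c] is different from 1, q^-1, q^-2, ... *)
Definition qadmissible (c q : C) : Prop := forall m : nat, c <> / q ^ m.

(* f 1 + ... + f l, equal to 0 for l = 0. *)
Definition csum1 (l : nat) (f : nat -> C) : C := sum_n_m f 1 l.

(* Main.v *)
(* For l = 1 the formulas are contiguous relations that hold coefficientwise:
   (aq;q)_m - (a;q)_m = a (1 - q^m) (aq;q)_{m-1}, where 1 - q^n cancels against
   (q;q)_n and an index shift lowers n (for m = n + k one first splits 1 - q^m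
   into a multiple of 1 - q^n and a multiple of 1 - q^k).  Replacing a by a q^r
   and telescoping gives general l.  To add the double series one needs that they
   converge: (a;q)_n is bounded and, for admissible c, (c;q)_n is bounded away
   from 0, so the terms are dominated by M |x|^n |y|^k. *)

Require Import Defs.
From Stdlib Require Import Reals Lra Lia FunctionalExtensionality.
From Coquelicot Require Import Coquelicot.

Open Scope C_scope.

(** * Convergence of dominated double series *)

Lemma Cmod_sum_n_le (f : nat -> C) (g : nat -> R) (N : nat) :
  (forall n, Cmod (f n) <= g n)%R -> (Cmod (sum_n f N) <= sum_n g N)%R.
Proof.
  intros H; induction N as [|N IH].
  - rewrite !sum_O; apply H.
  - rewrite !sum_Sn.
    apply Rle_trans with (1 := Cmod_triangle _ _).
    apply Rplus_le_compat; auto.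
Qed.

(** Enlarge the rectangle one side at a time, first rows and then columns. Each added row or column
    of [a] is dominated termwise by that of [b], and the triangle inequality adds up the
    increments. *)
Lemma Cmod_rect_sum_diff_le (a : nat -> nat -> C) (b : nat -> nat -> R)
  (N K N' K' : nat) :
  (forall n k, Cmod (a n k) <= b n k)%R -> (N <= N')%nat -> (K <= K')%nat ->
  (Cmod (sum_n (fun n => sum_n (fun k => a n k) K') N'
         - sum_n (fun n => sum_n (fun k => a n k) K) N)
   <= sum_n (fun n => sum_n (fun k => b n k) K') N'
      - sum_n (fun n => sum_n (fun k => b n k) K) N)%R.
Proof.
  intros Hab HN HK.
  assert (H1 : (Cmod (sum_n (fun n => sum_n (fun k => a n k) K) N'
         - sum_n (fun n => sum_n (fun k => a n k) K) N)
   <= sum_n (fun n => sum_n (fun k => b n k) K) N'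
      - sum_n (fun n => sum_n (fun k => b n k) K) N)%R).
  { induction HN as [|N' HN IH].
    - rewrite Rminus_diag; unfold Cminus; rewrite Cplus_opp_r, Cmod_0; lra.
    - rewrite !sum_Sn.
      pose proof (Cmod_sum_n_le (fun k => a (S N') k) (fun k => b (S N') k) K
                    (fun k => Hab (S N') k)) as Hrow.
      change (@plus C_AbelianMonoid) with Cplus.
      change (@plus R_AbelianMonoid) with Rplus.
      match goal with |- (Cmod (?u + ?v - ?w) <= _)%R =>
        replace (u + v - w) with ((u - w) + v) by ring end.
      apply Rle_trans with (1 := Cmod_triangle _ _).
      lra. }
  assert (H2 : (Cmod (sum_n (fun n => sum_n (fun k => a n k) K') N'
         - sum_n (fun n => sum_n (fun k => a n k) K) N')
   <= sum_n (fun n => sum_n (fun k => b n k) K') N'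
      - sum_n (fun n => sum_n (fun k => b n k) K) N')%R).
  { clear H1; induction HK as [|K' HK IH].
    - rewrite Rminus_diag; unfold Cminus; rewrite Cplus_opp_r, Cmod_0; lra.
    - pose proof (Cmod_sum_n_le (fun n => a n (S K')) (fun n => b n (S K')) N'
                    (fun n => Hab n (S K'))) as Hcol.
      rewrite (sum_n_ext (fun n => sum_n (fun k => a n k) (S K'))
                 (fun n => plus (sum_n (fun k => a n k) K') (a n (S K'))))
        by (intros n; apply sum_Sn).
      rewrite (sum_n_ext (fun n => sum_n (fun k => b n k) (S K'))
                 (fun n => plus (sum_n (fun k => b n k) K') (b n (S K'))))
        by (intros n; apply sum_Sn).
      rewrite !sum_n_plus.
      change (@plus C_AbelianMonoid) with Cplus.
      change (@plus R_AbelianMonoid) with Rplus.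
      match goal with |- (Cmod (?u + ?v - ?w) <= _)%R =>
        replace (u + v - w) with ((u - w) + v) by ring end.
      apply Rle_trans with (1 := Cmod_triangle _ _).
      lra. }
  match goal with |- (Cmod (?u - ?w) <= _)%R =>
    replace (u - w) with
      ((u - sum_n (fun n => sum_n (fun k => a n k) K) N')
       + (sum_n (fun n => sum_n (fun k => a n k) K) N' - w)) by ring end.
  apply Rle_trans with (1 := Cmod_triangle _ _).
  lra.
Qed.

(** By completeness of [C] the Cauchy criterion suffices: past a suitable corner, every rectangular
    sum of [a] stays close to the sum [S0] at that corner, because the sums of [b] hardly change
    there. *)
Lemma is_dseries_dominated (a : nat -> nat -> C) (b : nat -> nat -> R) (s : R) :
  (forall n k, Cmod (a n k) <= b n k)%R ->
  filterlim (fun NK : nat * nat =>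
      sum_n (fun n => sum_n (fun k => b n k) (snd NK)) (fst NK))
    (filter_prod eventually eventually) (locally s) ->
  exists t, is_dseries a t.
Proof.
  intros Hab Hb.
  apply (filterlim_locally_cauchy (U := C_CompleteNormedModule)).
  intros eps.
  (* With tolerance [eps / 4] around the limit, two sums of [b] differ by less than [eps / 2];
     comparing two sums of [a] through [S0] then costs less than [eps]. *)
  pose proof (proj1 (filterlim_locally _ _) Hb (pos_div_2 (pos_div_2 eps))) as He.
  destruct He as [P Q [N0 HP] [K0 HQ] HPQ].
  pose (S0 := sum_n (fun n => sum_n (fun k => a n k) K0) N0).
  pose (T := fun NK : nat * nat =>
      sum_n (fun n => sum_n (fun k => b n k) (snd NK)) (fst NK)).
  exists (fun NK => (N0 <= fst NK)%nat /\ (K0 <= snd NK)%nat); split.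
  { exists (fun N => (N0 <= N)%nat) (fun K => (K0 <= K)%nat).
    - exists N0; auto.
    - exists K0; auto.
    - intros; simpl; auto. }
  assert (Hnear : forall NK, (N0 <= fst NK)%nat /\ (K0 <= snd NK)%nat ->
    (Cmod (sum_n (fun n => sum_n (fun k => a n k) (snd NK)) (fst NK) - S0)
      < eps / 2)%R).
  { intros [N K]; simpl; intros [HN HK].
    pose proof (Cmod_rect_sum_diff_le a b N0 K0 N K Hab HN HK) as Hd.
    pose proof (HPQ N K (HP _ HN) (HQ _ HK)) as Hu.
    pose proof (HPQ N0 K0 (HP _ (le_n _)) (HQ _ (le_n _))) as Hv.
    apply Rabs_lt_between' in Hu. apply Rabs_lt_between' in Hv.
    simpl in Hu, Hv. unfold S0. lra. }
  intros u v Hu Hv.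
  apply Hnear in Hu. apply Hnear in Hv.
  (* The goal is a ball of the uniform structure of [C]; a bound on [Cmod] of the difference implies
     it. *)
  apply C_NormedModule_mixin_compat1.
  match goal with |- (Cmod (minus ?v ?u) < _)%R =>
    change (minus v u) with (v - u); replace (v - u) with ((v - S0) + - (u - S0)) by ring end.
  apply Rle_lt_trans with (1 := Cmod_triangle _ _).
  rewrite Cmod_opp. lra.
Qed.

(** The rectangular sums of the bound factor into [M] times two geometric partial sums, so they
    converge as a product of limits. *)
Lemma is_dseries_geom_bound (a : nat -> nat -> C) (M r t : R) :
  (0 <= r < 1)%R -> (0 <= t < 1)%R ->
  (forall n k, Cmod (a n k) <= M * r ^ n * t ^ k)%R ->
  exists s, is_dseries a s.
Proof.
  intros Hr Ht Ha.
  apply is_dseries_dominated with (1 := Ha) (s := (M * / (1 - r) * / (1 - t))%R).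
  apply filterlim_ext with
    (f := fun NK : nat * nat =>
       (M * sum_n (pow r) (fst NK) * sum_n (pow t) (snd NK))%R).
  { intros [N K]; simpl.
    assert (Hm : forall (c : R) (u : nat -> R) m,
      sum_n (fun i => c * u i)%R m = (c * sum_n u m)%R)
      by (intros; apply (sum_n_mult_l (K := R_Ring))).
    transitivity (sum_n (fun n => (M * sum_n (pow t) K * r ^ n)%R) N).
    - rewrite Hm; ring.
    - apply sum_n_ext; intros n. rewrite Hm.
      match goal with |- ?u = ?v => change (@eq R u v) end; ring. }
  assert (Hg : forall z, (0 <= z < 1)%R ->
     filterlim (sum_n (pow z)) eventually (locally (/ (1 - z))%R)).
  { intros z Hz. apply is_series_geom. rewrite Rabs_pos_eq; lra. }
  eapply filterlim_comp_2; [ eapply filterlim_comp_2 | | ].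
  - apply filterlim_const.
  - eapply filterlim_comp; [apply filterlim_fst | apply Hg, Hr].
  - apply (filterlim_mult (K := R_AbsRing)).
  - eapply filterlim_comp; [apply filterlim_snd | apply Hg, Ht].
  - apply (filterlim_mult (K := R_AbsRing)).
Qed.

(** * Linearity and index shifts of double series *)

Lemma DSeries_unique (a : nat -> nat -> C) (s : C) :
  is_dseries a s -> DSeries a = s.
Proof.
  intros H.
  apply (iota_filterlim_locally (V := C_CompleteNormedModule) _ _ H).
Qed.

Lemma is_dseries_ext (a b : nat -> nat -> C) (s : C) :
  (forall n k, a n k = b n k) -> is_dseries a s -> is_dseries b s.
Proof.
  intros H; apply filterlim_ext; intros [N K].
  apply sum_n_ext; intros n; apply sum_n_ext; intros k; apply H.
Qed.

Lemma is_dseries_plus (a b : nat -> nat -> C) (s t : C) :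
  is_dseries a s -> is_dseries b t ->
  is_dseries (fun n k => a n k + b n k) (s + t).
Proof.
  intros Ha Hb.
  eapply filterlim_ext;
    [| eapply filterlim_comp_2;
       [exact Ha | exact Hb | apply (filterlim_plus (V := C_NormedModule))]].
  intros [N K]; simpl.
  rewrite <- sum_n_plus; apply sum_n_ext; intros n.
  rewrite <- sum_n_plus; reflexivity.
Qed.

Lemma is_dseries_scal (c : C) (a : nat -> nat -> C) (s : C) :
  is_dseries a s -> is_dseries (fun n k => c * a n k) (c * s).
Proof.
  intros Ha.
  eapply filterlim_ext;
    [| eapply filterlim_comp;
       [exact Ha | apply (filterlim_scal_r (V := C_NormedModule) c)]].
  intros [N K]; simpl.
  change (@scal _ C_NormedModule) with (@mult C_Ring).
  etransitivity; [symmetry; apply (sum_n_mult_l (K := C_Ring) c)|].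
  apply sum_n_ext; intros n.
  symmetry; apply (sum_n_mult_l (K := C_Ring) c).
Qed.

Lemma is_dseries_shift_l (a : nat -> nat -> C) (s : C) :
  is_dseries a s ->
  is_dseries (fun n k => match n with O => 0 | S m => a m k end) s.
Proof.
  intros Ha.
  assert (H0 : forall K, sum_n (fun _ : nat => RtoC 0) K = RtoC 0).
  { induction K as [|K IH]; [apply sum_O|].
    rewrite sum_Sn, IH; apply Cplus_0_r. }
  assert (Hsum : forall N K,
    sum_n (fun n => sum_n (fun k => match n with O => RtoC 0 | S m => a m k end) K) (S N)
    = sum_n (fun n => sum_n (fun k => a n k) K) N).
  { intros N K; induction N as [|N IH].
    - rewrite sum_Sn, !sum_O, H0; apply Cplus_0_l.
    - rewrite sum_Sn, IH, sum_Sn; reflexivity. }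
  intros P HP. destruct (Ha P HP) as [Q R [N0 HQ] HR HQR].
  (* The shifted array begins with a zero row, so the threshold for rows rises by one. *)
  exists (fun N => (S N0 <= N)%nat) R; [exists (S N0); auto | assumption |].
  intros [|N] K HN HK; [lia|]. simpl.
  rewrite Hsum. apply (HQR N K); [apply HQ; lia | assumption].
Qed.

(** The finite sums commute, and the two sides of the rectangle play symmetric roles in the
    limit. *)
Lemma is_dseries_swap (a : nat -> nat -> C) (s : C) :
  is_dseries a s -> is_dseries (fun n k => a k n) s.
Proof.
  intros Ha P HP. destruct (Ha P HP) as [Q R HQ HR HQR].
  exists R Q; [assumption | assumption |].
  intros N K HN HK; simpl.
  rewrite sum_n_switch. apply (HQR K N); assumption.
Qed.

Lemma is_dseries_shift_r (a : nat -> nat -> C) (s : C) :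
  is_dseries a s ->
  is_dseries (fun n k => match k with O => 0 | S m => a n m end) s.
Proof.
  intros Ha.
  apply (is_dseries_swap (fun k n => match k with O => RtoC 0 | S m => a n m end)).
  apply (is_dseries_shift_l (fun m n => a n m)).
  apply is_dseries_swap, Ha.
Qed.

(** * Recursions and bounds for q-shifted factorials *)

Lemma qpoch_S_l (a q : C) (n : nat) :
  qpoch a q (S n) = (1 - a) * qpoch (a * q) q n.
Proof.
  induction n as [|n IH].
  - simpl; ring.
  - change (qpoch a q (S (S n))) with (qpoch a q (S n) * (1 - a * q ^ S n)).
    rewrite IH; simpl; ring.
Qed.

(** After factoring out [qpoch (a * q) q n], this is [1 - a q^(n+1) = (1 - a) + a (1 - q^(n+1))]. *)
Lemma qpoch_S_sub (a q : C) (n : nat) :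
  qpoch (a * q) q (S n)
  = qpoch a q (S n) + a * (1 - q ^ S n) * qpoch (a * q) q n.
Proof.
  rewrite (qpoch_S_l a); simpl; ring.
Qed.

Lemma qpoch_neq_0 (c q : C) (n : nat) :
  q <> 0 -> qadmissible c q -> qpoch c q n <> 0.
Proof.
  intros Hq Hc; induction n as [|n IH]; simpl.
  - apply C1_nz.
  - apply Cmult_neq_0; [assumption|].
    intros H; apply (Hc n).
    assert (H1 : c * q ^ n = 1) by (replace (c * q ^ n) with (1 - (1 - c * q ^ n)) by ring; rewrite H; ring).
    apply (Cpow_nz q n) in Hq.
    rewrite <- (Cmult_1_l (/ q ^ n)), <- H1. field. assumption.
Qed.

Lemma qadmissible_mult (c q : C) :
  q <> 0 -> qadmissible c q -> qadmissible (c * q) q.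
Proof.
  intros Hq Hc m H; apply (Hc (S m)).
  rewrite Cpow_S.
  replace c with (c * q * / q) by (field; assumption).
  rewrite H; field; split; [apply Cpow_nz|]; assumption.
Qed.

(** An equality [q = / q ^ m] would force [|q|^(m+1) = 1]. This makes the denominators [(q;q)_n] an
    instance of the results for admissible [c]. *)
Lemma qadmissible_base (q : C) :
  q <> 0 -> (Cmod q < 1)%R -> qadmissible q q.
Proof.
  intros Hq Hq1 m H.
  assert (H1 : q ^ S m = 1).
  { rewrite Cpow_S, H at 1. field. apply Cpow_nz, Hq. }
  assert (H2 := f_equal Cmod H1).
  rewrite Cmod_pow, Cmod_1 in H2.
  pose proof (pow_lt_1_compat (Cmod q) (S m) (conj (Cmod_ge_0 q) Hq1) ltac:(lia)).
  lra.
Qed.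

(** Each factor satisfies [|1 - a q^j| <= 1 + |a| |q|^j <= exp (|a| |q|^j)], and the exponents form
    a convergent geometric series. *)
Lemma qpoch_Cmod_le (a q : C) :
  (Cmod q < 1)%R -> exists M, forall n, (Cmod (qpoch a q n) <= M)%R.
Proof.
  intros Hq. pose proof (Cmod_ge_0 q) as Hq0. pose proof (Cmod_ge_0 a) as Ha0.
  exists (exp (Cmod a / (1 - Cmod q))). intros n.
  assert (H : (Cmod (qpoch a q n)
            <= exp (Cmod a * ((1 - Cmod q ^ n) / (1 - Cmod q))))%R).
  { induction n as [|n IH].
    - simpl. rewrite Cmod_1. unfold Rdiv.
      rewrite Rminus_diag, Rmult_0_l, Rmult_0_r, exp_0; lra.
    - simpl qpoch. rewrite Cmod_mult.
      replace (Cmod a * ((1 - Cmod q ^ S n) / (1 - Cmod q)))%R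
        with (Cmod a * ((1 - Cmod q ^ n) / (1 - Cmod q)) + Cmod a * Cmod q ^ n)%R
        by (simpl; field; lra).
      rewrite exp_plus.
      apply Rmult_le_compat; try apply Cmod_ge_0; [exact IH|].
      apply Rle_trans with (1 + Cmod a * Cmod q ^ n)%R.
      + pose proof (Cmod_triangle 1 (- (a * q ^ n))) as Htr.
        rewrite Cmod_1, Cmod_opp, Cmod_mult, Cmod_pow in Htr; exact Htr.
      + apply exp_ineq1_le. }
  apply Rle_trans with (1 := H).
  assert (Hle : (Cmod a * ((1 - Cmod q ^ n) / (1 - Cmod q))
            <= Cmod a / (1 - Cmod q))%R).
  { unfold Rdiv. apply Rmult_le_compat_l; [assumption|].
    rewrite <- (Rmult_1_l (/ (1 - Cmod q))) at 2.
    apply Rmult_le_compat_r; [left; apply Rinv_0_lt_compat; lra|].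
    pose proof (pow_le _ n Hq0); lra. }
  destruct Hle as [Hlt|Heq]; [left; apply exp_increasing, Hlt | rewrite Heq; lra].
Qed.

(* Weierstrass' inequality [prod (1 - t_j) >= 1 - sum t_j] with [t_j = |c| |q|^j]. *)
Lemma qpoch_Cmod_ge_small (c q : C) (n : nat) :
  (Cmod q < 1)%R -> (Cmod c / (1 - Cmod q) <= / 2)%R ->
  (/ 2 <= Cmod (qpoch c q n))%R.
Proof.
  intros Hq Hc. pose proof (Cmod_ge_0 q) as Hq0. pose proof (Cmod_ge_0 c) as Hc0.
  assert (Hi : (0 < / (1 - Cmod q))%R) by (apply Rinv_0_lt_compat; lra).
  (* [s m] is the closed form of the sum of the [t_j] with [j < m]. *)
  set (s := fun m => (Cmod c / (1 - Cmod q) * (1 - Cmod q ^ m))%R).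
  assert (Hs : forall m, (0 <= s m <= / 2)%R).
  { intros m. pose proof (pow_le _ m Hq0).
    assert (Cmod q ^ m <= 1)%R by (rewrite <- (pow1 m); apply pow_incr; lra).
    assert (0 <= Cmod c / (1 - Cmod q))%R by (apply Rmult_le_pos; lra).
    unfold s; split; [apply Rmult_le_pos; lra|].
    apply Rle_trans with (Cmod c / (1 - Cmod q) * 1)%R; [|lra].
    apply Rmult_le_compat_l; lra. }
  assert (H : (1 - s n <= Cmod (qpoch c q n))%R).
  { induction n as [|n IH].
    - simpl. rewrite Cmod_1. pose proof (Hs O); lra.
    - simpl qpoch; rewrite Cmod_mult.
      set (t := (Cmod c * Cmod q ^ n)%R).
      assert (Hst : s (S n) = (s n + t)%R) by (unfold s, t; simpl; field; lra).
      assert (Ht : (1 - t <= Cmod (1 - c * q ^ n))%R).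
      { pose proof (Cmod_triangle (1 - c * q ^ n) (c * q ^ n)) as Htr.
        replace (1 - c * q ^ n + c * q ^ n) with (RtoC 1) in Htr by ring.
        rewrite Cmod_1, Cmod_mult, Cmod_pow in Htr. unfold t; lra. }
      assert (0 <= t)%R by (apply Rmult_le_pos; [|apply pow_le]; assumption).
      pose proof (Hs n). pose proof (Hs (S n)).
      (* Expanding the product leaves the surplus [s n * t], which is nonnegative. *)
      apply Rle_trans with ((1 - s n) * (1 - t))%R; [nra|].
      apply Rmult_le_compat; lra. }
  pose proof (Hs n); lra.
Qed.

(** For large [N] the parameter [c q^N] is small enough for the preceding estimate. Induction on [N]
    reaches it by peeling off the leading factor [1 - c], which is nonzero by admissibility, and
    passing to [c q]. *)
Lemma qpoch_Cmod_ge (c q : C) :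
  q <> 0 -> (Cmod q < 1)%R -> qadmissible c q ->
  exists d, (0 < d)%R /\ forall n, (d <= Cmod (qpoch c q n))%R.
Proof.
  intros Hq Hq1 Hc. pose proof (Cmod_ge_0 q) as Hq0.
  assert (HN : exists N, (Cmod (c * q ^ N) / (1 - Cmod q) <= / 2)%R).
  { assert (Hl : is_lim_seq (fun n => Cmod c / (1 - Cmod q) * Cmod q ^ n)%R 0).
    { replace (Finite 0) with (Rbar_mult (Cmod c / (1 - Cmod q))%R 0)
        by (simpl; rewrite Rmult_0_r; reflexivity).
      apply is_lim_seq_scal_l, is_lim_seq_geom.
      rewrite Rabs_pos_eq; lra. }
    apply is_lim_seq_spec in Hl.
    destruct (Hl (mkposreal (/ 2) ltac:(lra))) as [N HN].
    exists N. specialize (HN N (le_n _)). simpl in HN.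
    rewrite Rminus_0_r in HN. apply Rabs_def2 in HN.
    rewrite Cmod_mult, Cmod_pow. unfold Rdiv in *. lra. }
  destruct HN as [N HN]. revert c Hc HN.
  induction N as [|N IH]; intros c Hc HN.
  - exists (/ 2)%R; split; [lra|]. intros n.
    apply qpoch_Cmod_ge_small; [assumption|].
    simpl in HN; rewrite Cmult_1_r in HN; assumption.
  - destruct (IH (c * q)) as [d [Hd Hdn]].
    + apply qadmissible_mult; assumption.
    + rewrite Cpow_S, Cmult_assoc in HN; assumption.
    + assert (H1 : (0 < Cmod (1 - c))%R).
      { apply Cmod_gt_0. pose proof (qpoch_neq_0 c q 1 Hq Hc) as H.
        simpl in H. intros E; apply H. rewrite Cmult_1_r, E; ring. }
      (* The value 1 covers the empty product [n = 0]. *)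
      exists (Rmin 1 (Cmod (1 - c) * d)); split.
      * apply Rmin_glb_lt; [lra | apply Rmult_lt_0_compat; assumption].
      * intros [|n].
        -- simpl; rewrite Cmod_1; apply Rmin_l.
        -- apply Rle_trans with (1 := Rmin_r _ _).
           rewrite qpoch_S_l, Cmod_mult.
           apply Rmult_le_compat_l; [lra | apply Hdn].
Qed.

(** * Series with a Humbert denominator and a general numerator *)

Definition bounded2 (w : nat -> nat -> C) : Prop :=
  exists M, forall n k, (Cmod (w n k) <= M)%R.

Lemma bounded2_mult (u v : nat -> nat -> C) :
  bounded2 u -> bounded2 v -> bounded2 (fun n k => u n k * v n k).
Proof.
  intros [M HM] [N HN]; exists (M * N)%R; intros n k.
  rewrite Cmod_mult; apply Rmult_le_compat; auto using Cmod_ge_0.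
Qed.

Lemma bounded2_const (c : C) : bounded2 (fun _ _ => c).
Proof. exists (Cmod c); intros; apply Rle_refl. Qed.

Lemma bounded2_qpoch (a q : C) (f : nat -> nat -> nat) :
  (Cmod q < 1)%R -> bounded2 (fun n k => qpoch a q (f n k)).
Proof.
  intros Hq; destruct (qpoch_Cmod_le a q Hq) as [M HM].
  exists M; intros; apply HM.
Qed.

Lemma bounded2_pow (q : C) (f : nat -> nat -> nat) :
  (Cmod q < 1)%R -> bounded2 (fun n k => q ^ f n k).
Proof.
  intros Hq; exists 1%R; intros n k; pose proof (Cmod_ge_0 q).
  rewrite Cmod_pow, <- (pow1 (f n k)); apply pow_incr; lra.
Qed.

(** The three Humbert functions share this denominator and differ only in the numerator [w], so
    convergence and the contiguous relations can be treated once. *)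
Definition humbert_term (w : nat -> nat -> C) (c q x y : C) (n k : nat) : C :=
  w n k / (qpoch c q (n + k) * qpoch q q n * qpoch q q k) * x ^ n * y ^ k.

(** With [d] and [e] bounding [|(c;q)_n|] and [|(q;q)_n|] from below, the terms are at most
    [M / (d e e) |x|^n |y|^k]. *)
Lemma is_dseries_humbert (w : nat -> nat -> C) (c q x y : C) :
  q <> 0 -> (Cmod q < 1)%R -> (Cmod x < 1)%R -> (Cmod y < 1)%R ->
  qadmissible c q -> bounded2 w ->
  exists s, is_dseries (humbert_term w c q x y) s.
Proof.
  intros Hq Hq1 Hx Hy Hc [M HM].
  destruct (qpoch_Cmod_ge c q Hq Hq1 Hc) as [d [Hd Hdn]].
  destruct (qpoch_Cmod_ge q q Hq Hq1 (qadmissible_base q Hq Hq1)) as [e [He Hen]].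
  apply is_dseries_geom_bound with (M := (M * / (d * e * e))%R)
    (r := Cmod x) (t := Cmod y);
    [split; [apply Cmod_ge_0 | assumption].. |].
  intros n k; unfold humbert_term, Cdiv.
  rewrite 3!Cmod_mult, !Cmod_pow.
  apply Rmult_le_compat_r; [apply pow_le, Cmod_ge_0|].
  apply Rmult_le_compat_r; [apply pow_le, Cmod_ge_0|].
  assert (Hpos : (0 < d * e * e)%R) by (repeat apply Rmult_lt_0_compat; assumption).
  assert (H : (d * e * e
    <= Cmod (qpoch c q (n + k) * qpoch q q n * qpoch q q k))%R).
  { rewrite !Cmod_mult.
    apply Rmult_le_compat; [nra | lra | | apply Hen].
    apply Rmult_le_compat; [lra | lra | apply Hdn | apply Hen]. }
  rewrite Cmod_inv by (apply Cmod_gt_0; lra).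
  apply Rmult_le_compat; [apply Cmod_ge_0 | | apply HM | apply Rinv_le_contravar; lra].
  left; apply Rinv_0_lt_compat; lra.
Qed.

(* The factors [1 - q ^ S m] cancel the last factor of [(q;q)_{m+1}]; the index
   shift then turns [(c;q)_{m+1}] into [(1 - c) (c q;q)_m]. *)
Lemma humbert_contiguous (w w' u v : nat -> nat -> C) (p r c q x y : C) :
  q <> 0 -> (Cmod q < 1)%R -> (Cmod x < 1)%R -> (Cmod y < 1)%R ->
  qadmissible c q -> bounded2 w -> bounded2 u -> bounded2 v ->
  (forall n k, w' n k = w n k
     + match n with O => 0 | S m => p * (1 - q ^ S m) * u m k end
     + match k with O => 0 | S m => r * (1 - q ^ S m) * v n m end) ->
  DSeries (humbert_term w' c q x y)
  = DSeries (humbert_term w c q x y)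
    + p * x / (1 - c) * DSeries (humbert_term u (c * q) q x y)
    + r * y / (1 - c) * DSeries (humbert_term v (c * q) q x y).
Proof.
  intros Hq Hq1 Hx Hy Hc Hw Hu Hv H.
  pose proof (qadmissible_mult c q Hq Hc) as Hcq.
  destruct (is_dseries_humbert w c q x y) as [sw Hsw]; auto.
  destruct (is_dseries_humbert u (c * q) q x y) as [su Hsu]; auto.
  destruct (is_dseries_humbert v (c * q) q x y) as [sv Hsv]; auto.
  rewrite (DSeries_unique _ _ Hsw), (DSeries_unique _ _ Hsu),
    (DSeries_unique _ _ Hsv).
  apply DSeries_unique.
  eapply is_dseries_ext;
    [| exact (is_dseries_plus _ _ _ _
         (is_dseries_plus _ _ _ _ Hsw
            (is_dseries_scal (p * x / (1 - c)) _ _ (is_dseries_shift_l _ _ Hsu)))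
         (is_dseries_scal (r * y / (1 - c)) _ _ (is_dseries_shift_r _ _ Hsv)))].
  assert (Hc1 : 1 - c <> 0).
  { pose proof (qpoch_neq_0 c q 1 Hq Hc) as H1; simpl in H1.
    intros E; apply H1; rewrite Cmult_1_r, E; ring. }
  assert (HP : forall m, qpoch (c * q) q m <> 0)
    by (intros; apply qpoch_neq_0; assumption).
  assert (HQ : forall m, qpoch q q m <> 0)
    by (intros; apply qpoch_neq_0; [|apply qadmissible_base]; assumption).
  assert (HQS : forall m, qpoch q q (S m) = qpoch q q m * (1 - q ^ S m))
    by reflexivity.
  assert (Hf : forall m, 1 - q ^ S m <> 0).
  { intros m E; apply (HQ (S m)); rewrite HQS, E; ring. }
  intros n k; simpl; unfold humbert_term; rewrite H.
  assert (Hl : forall m, p * x / (1 - c)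
     * (u m k / (qpoch (c * q) q (m + k) * qpoch q q m * qpoch q q k) * x ^ m * y ^ k)
     = p * (1 - q ^ S m) * u m k
       / (qpoch c q (S m + k) * qpoch q q (S m) * qpoch q q k) * x ^ S m * y ^ k).
  { intros m; change (S m + k)%nat with (S (m + k)).
    rewrite qpoch_S_l, HQS, (Cpow_S x). field; auto. }
  assert (Hr : forall m, r * y / (1 - c)
     * (v n m / (qpoch (c * q) q (n + m) * qpoch q q n * qpoch q q m) * x ^ n * y ^ m)
     = r * (1 - q ^ S m) * v n m
       / (qpoch c q (n + S m) * qpoch q q n * qpoch q q (S m)) * x ^ n * y ^ S m).
  { intros m; rewrite <- plus_n_Sm.
    rewrite qpoch_S_l, HQS, (Cpow_S y). field; auto. }
  (* On the edges [n = 0] and [k = 0] the zero entries of the shifted arrays match the zero branches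
     in [H]. *)
  destruct n as [|n], k as [|k]; rewrite ?Hl, ?Hr; unfold Cdiv; ring.
Qed.

(** * Contiguous relations of the three functions *)

Lemma DSeries_ext (a b : nat -> nat -> C) :
  (forall n k, a n k = b n k) -> DSeries a = DSeries b.
Proof.
  intros Hab; f_equal.
  apply functional_extensionality; intros n.
  apply functional_extensionality; intros k; apply Hab.
Qed.

Ltac solve_bounded2 :=
  repeat apply bounded2_mult;
  solve [ apply bounded2_const | apply bounded2_qpoch; assumption
        | apply bounded2_pow; assumption ].

Ltac solve_Phi_ext :=
  apply DSeries_ext; intros; unfold humbert_term; rewrite ?Cpow_mult_l;
  unfold Cdiv; ring.

(* [1 - q^(n+k) = (1 - q^n) + q^n (1 - q^k)] *)
Lemma Phi1_contiguous_a_qx (q a b c x y : C) :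
  q <> 0 -> (Cmod q < 1)%R -> (Cmod x < 1)%R -> (Cmod y < 1)%R ->
  qadmissible c q ->
  Phi1 (a * q) b c q x y
  = Phi1 a b c q x y
    + a * (1 - b) * x / (1 - c) * Phi1 (a * q) (b * q) (c * q) q x y
    + a * y / (1 - c) * Phi1 (a * q) b (c * q) q (q * x) y.
Proof.
  intros Hq Hq1 Hx Hy Hc.
  etransitivity; [apply (humbert_contiguous
    (fun n k => qpoch a q (n + k) * qpoch b q n)
    (fun n k => qpoch (a * q) q (n + k) * qpoch b q n)
    (fun n k => qpoch (a * q) q (n + k) * qpoch (b * q) q n)
    (* The weight [q ^ n] is later absorbed into [x ^ n], which produces the argument [q * x]. *)
    (fun n k => q ^ n * (qpoch (a * q) q (n + k) * qpoch b q n))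
    (a * (1 - b)) a); try assumption; try solve_bounded2|].
  - intros [|n] [|k].
    + simpl; ring.
    + change (0 + S k)%nat with (S (0 + k)). rewrite qpoch_S_sub. simpl; ring.
    + change (S n + 0)%nat with (S (n + 0)).
      rewrite qpoch_S_sub, (qpoch_S_l b), <- plus_n_O; ring.
    + change (S n + S k)%nat with (S (n + S k)).
      rewrite qpoch_S_sub, (qpoch_S_l b).
      replace (S n + k)%nat with (n + S k)%nat by lia.
      rewrite (Cpow_S q (n + S k)), Cpow_add_r, (Cpow_S q n); ring.
  - f_equal; f_equal; solve_Phi_ext.
Qed.

(* [1 - q^(n+k) = (1 - q^k) + q^k (1 - q^n)] *)
Lemma Phi1_contiguous_a_qy (q a b c x y : C) :
  q <> 0 -> (Cmod q < 1)%R -> (Cmod x < 1)%R -> (Cmod y < 1)%R ->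
  qadmissible c q ->
  Phi1 (a * q) b c q x y
  = Phi1 a b c q x y
    + a * y / (1 - c) * Phi1 (a * q) b (c * q) q x y
    + a * (1 - b) * x / (1 - c) * Phi1 (a * q) (b * q) (c * q) q x (q * y).
Proof.
  intros Hq Hq1 Hx Hy Hc.
  (* [humbert_contiguous] lists the x-part first, so the last two summands are exchanged. *)
  rewrite <- Cplus_assoc, (Cplus_comm (_ * _ / _ * _)), Cplus_assoc.
  etransitivity; [apply (humbert_contiguous
    (fun n k => qpoch a q (n + k) * qpoch b q n)
    (fun n k => qpoch (a * q) q (n + k) * qpoch b q n)
    (fun n k => q ^ k * (qpoch (a * q) q (n + k) * qpoch (b * q) q n))
    (fun n k => qpoch (a * q) q (n + k) * qpoch b q n)
    (a * (1 - b)) a); try assumption; try solve_bounded2|].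
  - intros [|n] [|k].
    + simpl; ring.
    + change (0 + S k)%nat with (S (0 + k)). rewrite qpoch_S_sub. simpl; ring.
    + change (S n + 0)%nat with (S (n + 0)).
      rewrite qpoch_S_sub, (qpoch_S_l b), <- plus_n_O; simpl; ring.
    + change (S n + S k)%nat with (S (n + S k)).
      rewrite qpoch_S_sub, (qpoch_S_l b).
      replace (S n + k)%nat with (n + S k)%nat by lia.
      rewrite (Cpow_S q (n + S k)), Cpow_add_r, (Cpow_S q n); ring.
  - f_equal; f_equal; f_equal; solve_Phi_ext.
Qed.

(** Only [(b;q)_n] changes, so only [n] is lowered. The factor
    [(a;q)_{n+k} = (1 - a) (a q;q)_{n+k-1}] must follow the shift, which raises [a] as well and
    yields the prefactor [1 - a]. *)
Lemma Phi1_contiguous_b (q a b c x y : C) :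
  q <> 0 -> (Cmod q < 1)%R -> (Cmod x < 1)%R -> (Cmod y < 1)%R ->
  qadmissible c q ->
  Phi1 a (b * q) c q x y
  = Phi1 a b c q x y
    + b * (1 - a) * x / (1 - c) * Phi1 (a * q) (b * q) (c * q) q x y.
Proof.
  intros Hq Hq1 Hx Hy Hc.
  etransitivity; [apply (humbert_contiguous
    (fun n k => qpoch a q (n + k) * qpoch b q n)
    (fun n k => qpoch a q (n + k) * qpoch (b * q) q n)
    (fun n k => qpoch (a * q) q (n + k) * qpoch (b * q) q n)
    (fun n k => 0)
    (b * (1 - a)) 0); try assumption; try solve_bounded2|].
  - intros [|n] k; destruct k as [|k]; try (simpl; ring).
    + rewrite qpoch_S_sub; change (S n + 0)%nat with (S (n + 0));
      rewrite (qpoch_S_l a); ring.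
    + rewrite qpoch_S_sub; change (S n + S k)%nat with (S (n + S k));
      rewrite (qpoch_S_l a); ring.
  - unfold Phi1, humbert_term, Cdiv; ring.
Qed.

(** Here [a] occurs only in [(a;q)_n], so lowering [n] leaves [(b;q)_k] intact and the y-part of the
    general relation is zero. *)
Lemma Phi2_contiguous_a (q a b c x y : C) :
  q <> 0 -> (Cmod q < 1)%R -> (Cmod x < 1)%R -> (Cmod y < 1)%R ->
  qadmissible c q ->
  Phi2 (a * q) b c q x y
  = Phi2 a b c q x y + a * x / (1 - c) * Phi2 (a * q) b (c * q) q x y.
Proof.
  intros Hq Hq1 Hx Hy Hc.
  etransitivity; [apply (humbert_contiguous
    (fun n k => qpoch a q n * qpoch b q k)
    (fun n k => qpoch (a * q) q n * qpoch b q k)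
    (fun n k => qpoch (a * q) q n * qpoch b q k)
    (fun n k => 0) a 0); try assumption; try solve_bounded2|].
  - intros [|n] k; destruct k as [|k]; rewrite ?qpoch_S_sub; simpl; ring.
  - unfold Phi2, humbert_term, Cdiv; ring.
Qed.

Lemma Phi2_contiguous_b (q a b c x y : C) :
  q <> 0 -> (Cmod q < 1)%R -> (Cmod x < 1)%R -> (Cmod y < 1)%R ->
  qadmissible c q ->
  Phi2 a (b * q) c q x y
  = Phi2 a b c q x y + b * y / (1 - c) * Phi2 a (b * q) (c * q) q x y.
Proof.
  intros Hq Hq1 Hx Hy Hc.
  etransitivity; [apply (humbert_contiguous
    (fun n k => qpoch a q n * qpoch b q k)
    (fun n k => qpoch a q n * qpoch (b * q) q k)
    (fun n k => 0)
    (fun n k => qpoch a q n * qpoch (b * q) q k)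
    0 b); try assumption; try solve_bounded2|].
  - intros n k; destruct n as [|n], k as [|k]; rewrite ?(qpoch_S_sub b); simpl; ring.
  - unfold Phi2, humbert_term, Cdiv; ring.
Qed.

Lemma Phi3_contiguous_a (q a c x y : C) :
  q <> 0 -> (Cmod q < 1)%R -> (Cmod x < 1)%R -> (Cmod y < 1)%R ->
  qadmissible c q ->
  Phi3 (a * q) c q x y
  = Phi3 a c q x y + a * x / (1 - c) * Phi3 (a * q) (c * q) q x y.
Proof.
  intros Hq Hq1 Hx Hy Hc.
  etransitivity; [apply (humbert_contiguous
    (fun n k => qpoch a q n)
    (fun n k => qpoch (a * q) q n)
    (fun n k => qpoch (a * q) q n)
    (fun n k => 0) a 0); try assumption; try solve_bounded2|].
  - intros [|n] k; destruct k as [|k]; rewrite ?qpoch_S_sub; simpl; ring.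
  - unfold Phi3, humbert_term, Cdiv; ring.
Qed.

(** * Telescoping, and powers of [q] with complex exponents *)

Lemma csum1_S (l : nat) (f : nat -> C) : csum1 (S l) f = csum1 l f + f (S l).
Proof. apply (sum_n_Sm f 1 l); lia. Qed.

Lemma csum1_0 (f : nat -> C) : csum1 0 f = 0.
Proof. apply (sum_n_m_zero f 1 0); lia. Qed.

(** At the parameter [a q^r] the prefactor of a contiguous relation carries [q^r]; summing the steps
    and renumbering from 1 turns it into [q^(r-1)]. *)
Lemma csum1_telescope2 (F G H : nat -> C) (A B q : C) (l : nat) :
  (forall r, F (S r) = F r + A * q ^ r * G (S r) + B * q ^ r * H (S r)) ->
  F l = F O + A * csum1 l (fun r => q ^ (r - 1) * G r)
            + B * csum1 l (fun r => q ^ (r - 1) * H r).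
Proof.
  intros HF; induction l as [|l IH].
  - rewrite !csum1_0; ring.
  - rewrite HF, IH, !csum1_S; simpl (S l - 1)%nat; rewrite Nat.sub_0_r; ring.
Qed.

Lemma csum1_telescope (F G : nat -> C) (A q : C) (l : nat) :
  (forall r, F (S r) = F r + A * q ^ r * G (S r)) ->
  F l = F O + A * csum1 l (fun r => q ^ (r - 1) * G r).
Proof.
  intros HF.
  rewrite (csum1_telescope2 F G (fun _ => 0) A 0 q l) by (intros; rewrite HF; ring).
  ring.
Qed.

Lemma Cexp_plus (z w : C) : Cexp (z + w) = Cexp z * Cexp w.
Proof.
  unfold Cexp, Cmult, Cplus; simpl.
  rewrite exp_plus, cos_plus, sin_plus; f_equal; ring.
Qed.

Lemma qpow_plus_1 (L q s : C) : Cexp L = q -> qpow L (s + 1) = qpow L s * q.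
Proof.
  intros <-; unfold qpow.
  rewrite <- Cexp_plus; f_equal; ring.
Qed.

Lemma qpow_plus_S (L q s : C) (r : nat) : Cexp L = q ->
  qpow L (s + INR (S r)) = qpow L (s + INR r) * q.
Proof.
  intros HL; rewrite <- (qpow_plus_1 L q) by assumption.
  rewrite S_INR, RtoC_plus; f_equal; ring.
Qed.

Lemma qpow_plus_INR (L q s : C) (r : nat) : Cexp L = q ->
  qpow L (s + INR r) = qpow L s * q ^ r.
Proof.
  intros HL; induction r as [|r IH].
  - simpl; rewrite Cplus_0_r; ring.
  - rewrite (qpow_plus_S L q), IH by assumption; simpl; ring.
Qed.

(* In three of the six formulas the source has misprints that make them false:
   the second and third for Phi1 and the second for Phi2.  They are stated here
   in the form given by the contiguous relations for (q^alpha;q)_{n+k},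
   (q^beta;q)_n and (q^beta;q)_k; the printed versions had, respectively,
   - q^{beta+1} in the y-sum and q^beta in the x-sum;
   - Phi1(q^alpha, q^{beta+l}; q^{gamma+1}; q, x, y) as summand;
   - prefactor q^alpha y and Phi2(q^alpha, q^{beta+r}; q^{gamma+1}; q, q x, y)
     as summand. *)
Theorem theorem2p3 (q L alpha beta gamma x y : C) (l : nat)
  (hq0 : (0 < Cmod q)%R) (hq1 : (Cmod q < 1)%R) (hL : Cexp L = q)
  (hx : (Cmod x < 1)%R) (hy : (Cmod y < 1)%R) :
  (qadmissible (qpow L gamma) q ->
     Phi1 (qpow L (alpha + INR l)) (qpow L beta) (qpow L gamma) q x y
     = Phi1 (qpow L alpha) (qpow L beta) (qpow L gamma) q x y
       + qpow L alpha * x * (1 - qpow L beta) / (1 - qpow L gamma)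
         * csum1 l (fun r => q ^ (r - 1)
             * Phi1 (qpow L (alpha + INR r)) (qpow L (beta + 1))
                    (qpow L (gamma + 1)) q x y)
       + qpow L alpha * y / (1 - qpow L gamma)
         * csum1 l (fun r => q ^ (r - 1)
             * Phi1 (qpow L (alpha + INR r)) (qpow L beta)
                    (qpow L (gamma + 1)) q (q * x) y)
   /\
     Phi1 (qpow L (alpha + INR l)) (qpow L beta) (qpow L gamma) q x y
     = Phi1 (qpow L alpha) (qpow L beta) (qpow L gamma) q x y
       + qpow L alpha * y / (1 - qpow L gamma)
         * csum1 l (fun r => q ^ (r - 1)
             * Phi1 (qpow L (alpha + INR r)) (qpow L beta)
                    (qpow L (gamma + 1)) q x y)
       + qpow L alpha * x * (1 - qpow L beta) / (1 - qpow L gamma)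
         * csum1 l (fun r => q ^ (r - 1)
             * Phi1 (qpow L (alpha + INR r)) (qpow L (beta + 1))
                    (qpow L (gamma + 1)) q x (q * y))
   /\
     Phi1 (qpow L alpha) (qpow L (beta + INR l)) (qpow L gamma) q x y
     = Phi1 (qpow L alpha) (qpow L beta) (qpow L gamma) q x y
       + qpow L beta * x * (1 - qpow L alpha) / (1 - qpow L gamma)
         * csum1 l (fun r => q ^ (r - 1)
             * Phi1 (qpow L (alpha + 1)) (qpow L (beta + INR r))
                    (qpow L (gamma + 1)) q x y))
  /\
  (qadmissible (qpow L gamma) q ->
     Phi2 (qpow L (alpha + INR l)) (qpow L beta) (qpow L gamma) q x y
     = Phi2 (qpow L alpha) (qpow L beta) (qpow L gamma) q x y
       + qpow L alpha * x / (1 - qpow L gamma)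
         * csum1 l (fun r => q ^ (r - 1)
             * Phi2 (qpow L (alpha + INR r)) (qpow L beta)
                    (qpow L (gamma + 1)) q x y)
   /\
     Phi2 (qpow L alpha) (qpow L (beta + INR l)) (qpow L gamma) q x y
     = Phi2 (qpow L alpha) (qpow L beta) (qpow L gamma) q x y
       + qpow L beta * y / (1 - qpow L gamma)
         * csum1 l (fun r => q ^ (r - 1)
             * Phi2 (qpow L alpha) (qpow L (beta + INR r))
                    (qpow L (gamma + 1)) q x y))
  /\
  (qadmissible (qpow L beta) q ->
     Phi3 (qpow L (alpha + INR l)) (qpow L beta) q x y
     = Phi3 (qpow L alpha) (qpow L beta) q x y
       + qpow L alpha * x / (1 - qpow L beta)
         * csum1 l (fun r => q ^ (r - 1)
             * Phi3 (qpow L (alpha + INR r)) (qpow L (beta + 1)) q x y)).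

Proof.
  assert (Hq : q <> 0) by (apply Cmod_gt_0; assumption).
  assert (Hz : forall s, qpow L s = qpow L (s + INR 0))
    by (intros; simpl; rewrite Cplus_0_r; reflexivity).
  pose proof (fun s => qpow_plus_1 L q s hL) as H1.
  pose proof (fun s r => qpow_plus_S L q s r hL) as HS.
  pose proof (fun s r => qpow_plus_INR L q s r hL) as Hr.
  split; [intros Hc; split; [|split] | split; [intros Hc; split | intros Hc]].
  - rewrite (Hz alpha) at 1.
    apply (csum1_telescope2 (fun r => Phi1 (qpow L (alpha + INR r)) _ _ q x y)
      (fun r => Phi1 (qpow L (alpha + INR r)) _ _ q x y)
      (fun r => Phi1 (qpow L (alpha + INR r)) _ _ q (q * x) y)); intros r.
    rewrite !H1, HS, Phi1_contiguous_a_qx by assumption.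
    (* The prefactor [qpow L (alpha + INR r)] splits as [qpow L alpha * q ^ r], the form needed for
       telescoping. *)
    rewrite (Hr _ r); unfold Cdiv; ring.
  - rewrite (Hz alpha) at 1.
    apply (csum1_telescope2 (fun r => Phi1 (qpow L (alpha + INR r)) _ _ q x y)
      (fun r => Phi1 (qpow L (alpha + INR r)) _ _ q x y)
      (fun r => Phi1 (qpow L (alpha + INR r)) _ _ q x (q * y))); intros r.
    rewrite !H1, HS, Phi1_contiguous_a_qy by assumption.
    rewrite (Hr _ r); unfold Cdiv; ring.
  - rewrite (Hz beta) at 1.
    apply (csum1_telescope (fun r => Phi1 _ (qpow L (beta + INR r)) _ q x y)
      (fun r => Phi1 _ (qpow L (beta + INR r)) _ q x y)); intros r.
    rewrite !H1, HS, Phi1_contiguous_b by assumption.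
    rewrite (Hr _ r); unfold Cdiv; ring.
  - rewrite (Hz alpha) at 1.
    apply (csum1_telescope (fun r => Phi2 (qpow L (alpha + INR r)) _ _ q x y)
      (fun r => Phi2 (qpow L (alpha + INR r)) _ _ q x y)); intros r.
    rewrite !H1, HS, Phi2_contiguous_a by assumption.
    rewrite (Hr _ r); unfold Cdiv; ring.
  - rewrite (Hz beta) at 1.
    apply (csum1_telescope (fun r => Phi2 _ (qpow L (beta + INR r)) _ q x y)
      (fun r => Phi2 _ (qpow L (beta + INR r)) _ q x y)); intros r.
    rewrite !H1, HS, Phi2_contiguous_b by assumption.
    rewrite (Hr _ r); unfold Cdiv; ring.
  - rewrite (Hz alpha) at 1.
    apply (csum1_telescope (fun r => Phi3 (qpow L (alpha + INR r)) _ q x y)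
      (fun r => Phi3 (qpow L (alpha + INR r)) _ q x y)); intros r.
    rewrite !H1, HS, Phi3_contiguous_a by assumption.
    rewrite (Hr _ r); unfold Cdiv; ring.
Qed.
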